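(* Let $\Bbbk$ be an algebraically closed field and $A$ a basic finite-dimensional unital $\Bbbk$-algebra. Assume $\mathrm{F}$ is a selfadjoint endofunctor of $A\text{-}\mathrm{mod}$ satisfying $\mathrm{F}\circ\mathrm{F}\cong\mathrm{F}$. Then there exists a decomposition $A\cong B\oplus C$ into a direct sum of algebras (each unital or zero) such that $\mathrm{F}\cong\mathfrak{p}_B$.
   Context: $A\text{-}\mathrm{mod}$ is the category of finite-dimensional left $A$-modules; all functors are additive and $\Bbbk$-linear. A functor is selfadjoint if it is left adjoint to itself (equivalently right adjoint to itself). A decomposition $A\cong B\oplus C$ of algebras gives a decomposition $A\text{-}\mathrm{mod}=B\text{-}\mathrm{mod}\oplus C\text{-}\mathrm{mod}$; $\mathfrak{p}_B$ denotes the endofunctor of $A\text{-}\mathrm{mod}$ which acts as the identity on $B\text{-}\mathrm{mod}$ and as the zero functor on $C\text{-}\mathrm{mod}$. *)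

(* Defs.v *)
From HB Require Import structures.
From mathcomp Require Import all_boot all_order all_algebra all_field.
Set Implicit Arguments. Unset Strict Implicit. Unset Printing Implicit Defensive.
Import GRing.Theory.
Local Open Scope ring_scope.

(* Concrete model of A-mod: a finite-dimensional left A-module is k^n
   (column vectors) with an action rho : A -> 'M[k]_n, a . v = rho a *m v.
   Every finite-dimensional A-module is isomorphic to such a module, and
   A-module maps M -> N are the matrices f : 'M_(dim N, dim M) commuting
   with the actions. *)

Section ModCat.
Variables (k : fieldType) (A : falgType k).

Record fmod := FMod { fdim : nat; fact : A -> 'M[k]_fdim }.

Definition is_mod (M : fmod) : Prop :=
  [/\ forall (c : k) (a b : A), fact M (c *: a + b) = c *: fact M a + fact M b,
      fact M 1 = 1%:M
    & forall a b : A, fact M (a * b) = fact M a *m fact M b].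

Definition homs (M N : fmod) := 'M[k]_(fdim N, fdim M).

Definition is_hom (M N : fmod) (f : homs M N) : Prop :=
  forall a : A, f *m fact M a = fact N a *m f.

(* simple module: nonzero, and no invariant subspaces besides 0 and M
   (subspaces of k^n encoded by row spaces of transposes, mxalgebra style) *)
Definition is_simple (M : fmod) : Prop :=
  (0 < fdim M)%N /\
  forall W : 'M[k]_(fdim M),
    (forall a : A, (W *m (fact M a)^T <= W)%MS) ->
    \rank W = 0%N \/ \rank W = fdim M.

(* A basic (over algebraically closed k): every simple A-module is 1-dimensional *)
Definition basic_alg : Prop :=
  forall M : fmod, is_mod M -> is_simple M -> fdim M = 1%N.

Record endo := Endo {
  Fobj : fmod -> fmod;
  Fmor : forall M N : fmod, homs M N -> homs (Fobj M) (Fobj N) }.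

Definition is_functor (F : endo) : Prop :=
  [/\ forall M, is_mod M -> is_mod (Fobj F M),
      forall M N (f : homs M N), is_mod M -> is_mod N -> is_hom f ->
        is_hom (Fmor F f),
      forall M, is_mod M -> Fmor F (1%:M : homs M M) = 1%:M,
      forall M N P (f : homs M N) (g : homs N P),
        is_mod M -> is_mod N -> is_mod P -> is_hom f -> is_hom g ->
        Fmor F (g *m f : homs M P) = Fmor F g *m Fmor F f
    & forall M N (c : k) (f g : homs M N),
        is_mod M -> is_mod N -> is_hom f -> is_hom g ->
        Fmor F (c *: f + g) = c *: Fmor F f + Fmor F g].

Definition idF : endo := @Endo id (fun M N f => f).

Definition compF (F G : endo) : endo :=
  @Endo (fun M => Fobj F (Fobj G M)) (fun M N f => Fmor F (Fmor G f)).

Definition is_nat (F G : endo) (eta : forall M, homs (Fobj F M) (Fobj G M)) : Prop :=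
  (forall M, is_mod M -> is_hom (eta M)) /\
  (forall M N (f : homs M N), is_mod M -> is_mod N -> is_hom f ->
     eta N *m Fmor F f = Fmor G f *m eta M).

Definition nat_iso (F G : endo) : Prop :=
  exists (eta : forall M, homs (Fobj F M) (Fobj G M))
         (theta : forall M, homs (Fobj G M) (Fobj F M)),
    [/\ is_nat eta, is_nat theta,
        forall M, is_mod M -> theta M *m eta M = 1%:M
      & forall M, is_mod M -> eta M *m theta M = 1%:M].

Definition adjoint (F G : endo) : Prop :=
  exists (unit : forall M, homs (Fobj idF M) (Fobj (compF G F) M))
         (counit : forall M, homs (Fobj (compF F G) M) (Fobj idF M)),
    [/\ is_nat unit, is_nat counit,
        forall M, is_mod M -> counit (Fobj F M) *m Fmor F (unit M) = 1%:M
      & forall M, is_mod M -> Fmor G (counit M) *m unit (Fobj G M) = 1%:M].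

Definition selfadjoint (F : endo) : Prop := adjoint F F.

(* decomposition A = B (+) C of algebras <-> central idempotent e, B = eA,
   C = (1-e)A *)
Definition central_idem (e : A) : Prop :=
  e * e = e /\ forall a : A, e * a = a * e.

(* p_B : M |-> eM (= the B-part of M), computed in a basis of the column
   space of rho(e): columns of U^T where U := row_base (rho e)^T *)
Definition pbasis (e : A) (M : fmod) := (row_base (fact M e)^T)^T.
Definition pcoord (e : A) (M : fmod) := (pinvmx (row_base (fact M e)^T))^T.

Definition pB (e : A) : endo :=
  @Endo (fun M => @FMod (\rank (fact M e)^T)
                   (fun a => pcoord e M *m fact M a *m pbasis e M))
        (fun M N f => pcoord e N *m f *m pbasis e M).

End ModCat.

(* Main.v *)
Require Import Defs.
From HB Require Import structures.
From mathcomp Require Import all_boot all_order all_algebra all_field.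
Local Open Scope ring_scope.

(** Let [eta : 1 -> FF] and [eps : FF -> 1] be the unit and the counit.  By the
    triangle identities [F eta] and [eta F] are split monomorphisms, and
    [eps F] and [F eps] are retractions of them.  All of these are maps between
    spaces of the same dimension, because [FF] is isomorphic to [F], so all
    four are isomorphisms.  Naturality of [eta] at [u := eta o eps : FF -> FF] gives
    [eta FF o u = FF u o eta FF], so [u] is an isomorphism as well.  Therefore
    [eps o u^-1 o eta] is an idempotent endomorphism of the identity functor
    whose image is [FF]; it is multiplication by a central idempotent [e], and
    [F], being isomorphic to [FF], is isomorphic to [M |-> eM].  *)

Set Implicit Arguments. Unset Strict Implicit. Unset Printing Implicit Defensive.
Import GRing.Theory VectorInternalTheory.

Lemma mulmx1_dim_eq (k : fieldType) m n (f : 'M[k]_(m, n)) (g : 'M[k]_(n, m)) :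
  f *m g = 1%:M -> g *m f = 1%:M -> m = n.
Proof.
move=> fg gf; apply/eqP; rewrite eqn_leq.
rewrite -{1}(mxrank1 k m) -fg (leq_trans (mxrankM_maxl f g) (rank_leq_col f)).
by rewrite -{1}(mxrank1 k n) -gf (leq_trans (mxrankM_maxr g f) (rank_leq_row f)).
Qed.

(** Destructing the equality of dimensions makes both matrices square, where a one-sided inverse is
    two-sided. *)
Lemma mulmx1C_dim (k : fieldType) m n (f : 'M[k]_(m, n)) (g : 'M[k]_(n, m)) :
  m = n -> f *m g = 1%:M -> g *m f = 1%:M.
Proof. by move=> mn; case: n / mn f g => f g; apply: mulmx1C. Qed.

(** * Composition and inversion of natural transformations *)

Section NaturalTransformations.
Variables (k : fieldType) (A : falgType k).
Implicit Types (M N P : fmod A) (F G H : endo A).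

Lemma is_hom_comp M N P (f : homs M N) (g : homs N P) :
  is_hom f -> is_hom g -> is_hom (g *m f : homs M P).
Proof. by move=> hf hg a; rewrite -mulmxA hf !mulmxA hg. Qed.

Lemma is_hom_inv M N (f : homs M N) (g : homs N M) :
  f *m g = 1%:M -> g *m f = 1%:M -> is_hom f -> is_hom g.
Proof.
move=> fg gf hf a; rewrite -[LHS]mulmx1 -fg !mulmxA.
by rewrite -(mulmxA g) -hf mulmxA gf mul1mx.
Qed.

Lemma is_nat_comp F G H (al : forall M, homs (Fobj F M) (Fobj G M))
    (be : forall M, homs (Fobj G M) (Fobj H M)) :
  is_nat al -> is_nat be -> @is_nat k A F H (fun M => be M *m al M).
Proof.
move=> [hal nal] [hbe nbe]; split=> [M mM|M N f mM mN hf].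
  by apply: is_hom_comp; [apply: hal | apply: hbe].
by rewrite -mulmxA nal // !mulmxA nbe.
Qed.

Lemma is_nat_inv F G (al : forall M, homs (Fobj F M) (Fobj G M))
    (be : forall M, homs (Fobj G M) (Fobj F M)) :
  (forall M, is_mod M -> al M *m be M = 1%:M) ->
  (forall M, is_mod M -> be M *m al M = 1%:M) ->
  is_nat al -> is_nat be.
Proof.
move=> ab ba [hal nal]; split=> [M mM|M N f mM mN hf].
  exact: is_hom_inv (ab M mM) (ba M mM) (hal M mM).
rewrite -[LHS]mulmx1 -(ab M mM) !mulmxA -(mulmxA (be N)) -nal //.
by rewrite mulmxA ba // mul1mx.
Qed.

Lemma nat_isoI F G (al : forall M, homs (Fobj F M) (Fobj G M))
    (be : forall M, homs (Fobj G M) (Fobj F M)) :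
  is_nat al ->
  (forall M, is_mod M -> be M *m al M = 1%:M) ->
  (forall M, is_mod M -> al M *m be M = 1%:M) ->
  nat_iso F G.
Proof.
by move=> nal ba ab; exists al, be; split=> //; apply: (is_nat_inv ab ba nal).
Qed.

Lemma nat_iso_sym F G : nat_iso F G -> nat_iso G F.
Proof. by move=> [al [be [nal nbe ba ab]]]; exists be, al. Qed.

Lemma nat_iso_trans F G H : nat_iso F G -> nat_iso G H -> nat_iso F H.
Proof.
move=> [al [be [nal nbe ba ab]]] [al' [be' [nal' nbe' ba' ab']]].
apply: (@nat_isoI _ _ (fun M => al' M *m al M) (fun M => be M *m be' M)).
- exact: is_nat_comp.
- by move=> M mM; rewrite -mulmxA (mulmxA (be' M)) ba' // mul1mx ba.
- by move=> M mM; rewrite -mulmxA (mulmxA (al M)) ab // mul1mx ab'.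
Qed.

Lemma nat_iso_fdim F G M : nat_iso F G -> is_mod M ->
  fdim (Fobj F M) = fdim (Fobj G M).
Proof.
move=> [al [be [_ _ ba ab]]] mM.
exact: mulmx1_dim_eq (ba M mM) (ab M mM).
Qed.

End NaturalTransformations.

(** * The regular module and the centre of [A] *)

Section RegularModule.
Variables (k : fieldType) (A : falgType k).

Definition cvec (a : A) : 'cV[k]_(dim A) := (v2r a)^T.

Definition uncvec (x : 'cV[k]_(dim A)) : A := r2v x^T.

(** The matrix of a linear [f] in the coordinates [cvec]; [lin1_mx] acts on row vectors, hence the
    two transpositions. *)
Definition cvec_mx n (f : A -> 'cV[k]_n) : 'M[k]_(n, dim A) :=
  (lin1_mx (fun u => (f (r2v u))^T))^T.

Lemma mul_cvec_mx n (f : A -> 'cV[k]_n) (a : A) :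
  linear f -> cvec_mx f *m cvec a = f a.
Proof.
move=> lf; pose g (u : 'rV[k]_(dim A)) := (f (r2v u))^T.
have lg : linear g by move=> c u v; rewrite /g linearP lf linearP.
pose g' : {linear 'rV[k]_(dim A) -> 'rV[k]_n} :=
  HB.pack g (GRing.isLinear.Build _ _ _ _ g lg).
by rewrite -trmx_mul (mul_rV_lin1 g') /= /g v2rK trmxK.
Qed.

Lemma cvec_inj : injective cvec.
Proof. by move=> a b /trmx_inj/(can_inj v2rK). Qed.

Lemma cvecK (x : 'cV[k]_(dim A)) : cvec (uncvec x) = x.
Proof. by rewrite /cvec r2vK trmxK. Qed.

Lemma cvec_linear : linear cvec.
Proof. by move=> c a b; rewrite /cvec !linearP. Qed.

Lemma eq_mx_cvec n (f g : 'M[k]_(n, dim A)) :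
  (forall a, f *m cvec a = g *m cvec a) -> f = g.
Proof.
move=> fg; apply/matrixP=> i j; have := fg (uncvec (delta_mx j 0)).
by rewrite cvecK -!colE => /matrixP/(_ i 0); rewrite !mxE.
Qed.

Definition regular_module : fmod A :=
  FMod (fun a : A => cvec_mx (fun b => cvec (a * b))).

Lemma fact_regular (a b : A) : fact regular_module a *m cvec b = cvec (a * b).
Proof.
by apply: mul_cvec_mx => c u v; rewrite mulrDr -scalerAr cvec_linear.
Qed.

Lemma regular_is_mod : is_mod regular_module.
Proof.
split=> [c a b||a b]; apply: eq_mx_cvec => x.
- by rewrite mulmxDl -scalemxAl !fact_regular mulrDl -scalerAl cvec_linear.
- by rewrite fact_regular mul1r mul1mx.
- by rewrite -mulmxA !fact_regular mulrA.
Qed.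

(** For a module [M], the map from the free module of rank one that sends [1] to [x]. *)
Definition orbit_map (M : fmod A) (x : 'cV[k]_(fdim M)) : homs regular_module M :=
  cvec_mx (fun a => fact M a *m x).

Lemma orbit_mapE (M : fmod A) (x : 'cV[k]_(fdim M)) (a : A) :
  is_mod M -> orbit_map x *m cvec a = fact M a *m x.
Proof.
by move=> [lM _ _]; apply: mul_cvec_mx => c u v; rewrite lM mulmxDl scalemxAl.
Qed.

Lemma orbit_map_is_hom (M : fmod A) (x : 'cV[k]_(fdim M)) :
  is_mod M -> is_hom (orbit_map x).
Proof.
move=> mM a; apply: eq_mx_cvec => b; case: (mM) => _ _ aM.
by rewrite -!mulmxA fact_regular !orbit_mapE // aM mulmxA.
Qed.

(** A Yoneda argument: [z] is the value of [p] at [1] in the regular module, and naturality along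
    the orbit map of [x] carries it to [p x = z x] in any [M]. Centrality holds because [p] on the
    regular module is [A]-linear: the image of [a] is both [z * a] and [a * z]. *)
Lemma nat_endo_id_center (p : forall M : fmod A, homs M M) :
  @is_nat k A (idF A) (idF A) p ->
  exists z : A, (forall a, z * a = a * z) /\
                (forall M, is_mod M -> p M = fact M z).
Proof.
move=> [hp np]; pose z := uncvec (p regular_module *m cvec 1).
have pz : p regular_module *m cvec 1 = cvec z by rewrite /z cvecK.
have pM M : is_mod M -> p M = fact M z.
  move=> mM; apply/matrixP=> i j; pose x : 'cV[k]_(fdim M) := delta_mx j 0.
  have /= nx := np _ _ _ regular_is_mod mM (orbit_map_is_hom x mM).
  (* The [j]-th columns are the images of the basis vector [x], itself the orbit map of [x] at
     [1]. *)
  suff: col j (p M) = col j (fact M z) by move/matrixP/(_ i 0); rewrite !mxE.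
  rewrite !colE -/x -(orbit_mapE x z mM) -pz mulmxA -nx -mulmxA orbit_mapE //.
  by case: mM => _ -> _; rewrite mul1mx.
exists z; split=> // a; apply: cvec_inj.
rewrite -fact_regular -(pM _ regular_is_mod) -(fact_regular a z) -pz mulmxA.
by rewrite -(hp _ regular_is_mod a) -mulmxA fact_regular mulr1.
Qed.

Lemma fact_regular_inj : injective (fact regular_module).
Proof.
move=> a b ab; apply: cvec_inj; rewrite -[a]mulr1 -[b]mulr1.
by rewrite -!fact_regular ab.
Qed.

End RegularModule.

(** * Splitting off the summand [eM] *)

Section CentralSummand.
Variables (k : fieldType) (A : falgType k) (e : A).
Hypothesis ee : e * e = e.
Implicit Types M N : fmod A.

Lemma pcoordK M : pcoord e M *m pbasis e M = 1%:M.
Proof. by rewrite -trmx_mul mulmxVp ?row_base_free // trmx1. Qed.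

(** The hypothesis puts the columns of [f] in the image of [e], so they are recovered from their
    coordinates in its basis. *)
Lemma pbasis_pcoord M n (f : 'M[k]_(fdim M, n)) :
  fact M e *m f = f -> pbasis e M *m (pcoord e M *m f) = f.
Proof.
move=> ef; apply: trmx_inj; rewrite !trmx_mul !trmxK mulmxKpV //.
by rewrite eq_row_base -ef trmx_mul submxMl.
Qed.

Lemma fact_pbasis M : is_mod M -> fact M e *m pbasis e M = pbasis e M.
Proof.
move=> [_ _ aM]; apply: trmx_inj; rewrite trmx_mul trmxK.
have /submxP[X ->] : (row_base (fact M e)^T <= (fact M e)^T)%MS.
  by rewrite eq_row_base.
by rewrite -mulmxA -trmx_mul -aM ee.
Qed.

(** The map [s] embeds [G M] into [M] with image [eM]; the isomorphism is [s] written in the chosen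
    basis of that image. *)
Lemma split_nat_iso_pB (G : endo A) (r : forall M, homs M (Fobj G M))
    (s : forall M, homs (Fobj G M) M) :
  @is_nat k A G (idF A) s ->
  (forall M, is_mod M -> r M *m s M = 1%:M) ->
  (forall M, is_mod M -> s M *m r M = fact M e) ->
  nat_iso G (pB e).
Proof.
move=> [hs ns] rs sr.
(* Here [e s = s r s = s]. *)
have es M : is_mod M -> fact M e *m s M = s M.
  by move=> mM; rewrite -sr // -mulmxA rs // mulmx1.
apply: (@nat_isoI k A G (pB e) (fun M => pcoord e M *m s M)
                               (fun M => r M *m pbasis e M)).
- split=> [M mM a|M N f mM mN hf] /=.
    by rewrite -!mulmxA pbasis_pcoord ?es // hs.
  by rewrite -!mulmxA pbasis_pcoord ?es // ns.
- by move=> M mM; rewrite -mulmxA pbasis_pcoord ?es ?rs.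
- by move=> M mM; rewrite -mulmxA (mulmxA (s M)) sr // fact_pbasis // pcoordK.
Qed.

End CentralSummand.

(** * Unit and counit of a selfadjoint functor with [FF] isomorphic to [F] *)

Section SelfadjointIdempotent.
Variables (k : fieldType) (A : falgType k) (F : endo A).
Variables (eta : forall M, homs (Fobj (idF A) M) (Fobj (compF F F) M)).
Variables (eps : forall M, homs (Fobj (compF F F) M) (Fobj (idF A) M)).
Hypothesis Ffun : is_functor F.
Hypothesis eta_nat : is_nat eta.
Hypothesis eps_nat : is_nat eps.
Hypothesis epsF_Feta :
  forall M, is_mod M -> eps (Fobj F M) *m Fmor F (eta M) = 1%:M.
Hypothesis Feps_etaF :
  forall M, is_mod M -> Fmor F (eps M) *m eta (Fobj F M) = 1%:M.
Hypothesis FF_F : nat_iso (compF F F) F.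
Implicit Types M N : fmod A.

Let FM M : is_mod M -> is_mod (Fobj F M).
Proof. by case: Ffun => + _ _ _ _; apply. Qed.

Let fdimFFF M : is_mod M ->
  fdim (Fobj F M) = fdim (Fobj F (Fobj F (Fobj F M))).
Proof.
by move=> mM; rewrite -(nat_iso_fdim FF_F mM) -(nat_iso_fdim FF_F (FM mM)).
Qed.

(** The triangle identity gives one order of composition; equality of the dimensions of [FM] and
    [FFFM] gives the other. *)
Lemma etaF_Feps M :
  is_mod M -> eta (Fobj F M) *m Fmor F (eps M) = 1%:M.
Proof. by move=> mM; apply: mulmx1C_dim (Feps_etaF mM); apply: fdimFFF. Qed.

Definition eta_eps M : homs (Fobj F (Fobj F M)) (Fobj F (Fobj F M)) :=
  eta M *m eps M.

(** With [u = eta_eps], this is [F eps_FM o F(u_FM) o eta_FFM]. The factor [F(u_FM)] cancels the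
    [FF(u_M)] that appears when [eta] is moved past [u_M], and [F eps_FM] then cancels [eta_FFM]. *)
Definition eta_eps_inv M : homs (Fobj F (Fobj F M)) (Fobj F (Fobj F M)) :=
  Fmor F (eps (Fobj F M)) *m
  (Fmor F (eta (Fobj F M) *m eps (Fobj F M) :
             homs (Fobj F (Fobj F (Fobj F M))) (Fobj F (Fobj F (Fobj F M))))
   *m eta (Fobj F (Fobj F M))).

Lemma eta_eps_nat : @is_nat k A (compF F F) (compF F F) eta_eps.
Proof. exact: is_nat_comp eps_nat eta_nat. Qed.

Lemma eta_epsVK M : is_mod M -> eta_eps_inv M *m eta_eps M = 1%:M.
Proof.
case: Ffun => _ Fhom F1 Fcomp _ mM; have [heta neta] := eta_nat.
have [heps neps] := eps_nat; have [hu _] := eta_eps_nat.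
have mFM := FM mM; have mFFM := FM mFM; have mFFFM := FM mFFM.
have hFu := Fhom _ _ _ mFFM mFFM (hu M mM).
have hv := is_hom_comp (heps _ mFM) (heta _ mFM).
(* The inner factors [eps_FM] and [F(eta_M)] cancel by a triangle identity, leaving
   [eta_FM o F(eps_M)]. *)
have vFu : eta (Fobj F M) *m eps (Fobj F M) *m Fmor F (eta_eps M) = 1%:M.
  rewrite (Fcomp _ _ _ (eps M) (eta M)) //; [|exact: heps|exact: heta].
  by rewrite -mulmxA (mulmxA (eps _)) epsF_Feta // mul1mx etaF_Feps.
rewrite /eta_eps_inv -!mulmxA.
have /= -> := neta _ _ (eta_eps M) mFFM mFFM (hu M mM).
by rewrite (mulmxA (Fmor F _) (Fmor F _) (eta _)) -Fcomp // vFu F1 // mul1mx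
  Feps_etaF.
Qed.

Lemma eta_epsKV M : is_mod M -> eta_eps M *m eta_eps_inv M = 1%:M.
Proof. by move=> mM; apply: mulmx1C; apply: eta_epsVK. Qed.

Lemma eta_eps_inv_nat : @is_nat k A (compF F F) (compF F F) eta_eps_inv.
Proof. exact: (@is_nat_inv _ _ (compF F F) (compF F F) eta_eps eta_eps_inv
          eta_epsKV eta_epsVK eta_eps_nat). Qed.

(** A right inverse of [eta]: [eta o eps o u^-1 = u o u^-1 = 1]. *)
Definition section M : homs (Fobj F (Fobj F M)) M := eps M *m eta_eps_inv M.

Lemma section_nat : @is_nat k A (compF F F) (idF A) section.
Proof. exact: is_nat_comp eta_eps_inv_nat eps_nat. Qed.

Lemma eta_section M : is_mod M -> eta M *m section M = 1%:M.
Proof. by move=> mM; rewrite mulmxA eta_epsKV. Qed.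

Lemma selfadjoint_idempotent_pB :
  exists e : A, central_idem e /\ nat_iso F (pB e).
Proof.
(* The element [e] represents the natural endomorphism [section o eta] of the identity functor. *)
have [e [Ce pe]] := nat_endo_id_center (is_nat_comp eta_nat section_nat).
have ee : e * e = e.
  (* The regular module is faithful, so idempotency of [e] can be checked on it, where it follows
     from [eta o section = 1]. *)
  apply: fact_regular_inj; have mA := regular_is_mod A.
  case: (mA) => _ _ ->; rewrite -pe //.
  by rewrite -mulmxA (mulmxA (eta _)) eta_section // mul1mx.
exists e; split; first by split.
apply: nat_iso_trans (nat_iso_sym FF_F) _.
exact: (split_nat_iso_pB ee section_nat eta_section).
Qed.

End SelfadjointIdempotent.

Theorem theorem16 (k : closedFieldType) (A : falgType k) (F : endo A) :
  basic_alg A ->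
  is_functor F ->
  selfadjoint F ->
  nat_iso (compF F F) F ->
  exists e : A, central_idem e /\ nat_iso F (pB e).
Proof.
move=> _ Ffun [eta [eps [eta_nat eps_nat epsF_Feta Feps_etaF]]] FF_F.
exact: selfadjoint_idempotent_pB eps_nat epsF_Feta Feps_etaF FF_F.
Qed.
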